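(* Let $V_1,\dots,V_n\in\mathcal B(H)$ be an arbitrary finite set of isometries on a Hilbert space $H$, generating a $C^*$-algebra $\mathcal A$. Then $G=\{V_1,\dots,V_n,\;V_1V_1^*+\cdots+V_nV_n^*\}$ is a hyperrigid generator for $\mathcal A$.
   Context: The $C^*$-algebra generated by a set of operators is the smallest norm-closed $*$-subalgebra containing it. UCP means unit-preserving and completely positive. All representations of $C^*$-algebras on Hilbert spaces are assumed nondegenerate. A finite or countably infinite set $G$ of generators of a $C^*$-algebra $A$ is called hyperrigid (a hyperrigid generator for $A$) if for every faithful (nondegenerate) representation of $A$ on a Hilbert space, written as an inclusion $A\subseteq\mathcal B(K)$, and every sequence of UCP maps $\phi_n:\mathcal B(K)\to\mathcal B(K)$, $n=1,2,\dots$, $$\lim_{n\to\infty}\|\phi_n(g)-g\|=0\ \ \forall g\in G\implies \lim_{n\to\infty}\|\phi_n(a)-a\|=0\ \ \forall a\in A.$$ *)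

(* Defs.v *)
From HB Require Import structures.
From mathcomp Require Import all_boot all_order all_algebra.
From mathcomp Require Import complex.
From mathcomp Require Import all_classical reals topology normedtype.

Set Implicit Arguments.
Unset Strict Implicit.
Unset Printing Implicit Defensive.

Import Order.TTheory GRing.Theory Num.Theory.
Import numFieldNormedType.Exports.

Local Open Scope classical_set_scope.
Local Open Scope ring_scope.
Local Open Scope complex_scope.

(* Complex Hilbert spaces over R[i]; the inner product is linear in its first
   argument and conjugate-linear in the second.  The space {0} is allowed. *)
HB.mixin Record CompleteNormedModule_isHilbert (R : realType) H
    & CompleteNormedModule R[i] H := {
  inner : {dot H for (@Num.conj R[i])};
  sqr_norm_inner : forall x : H, `|x| ^+ 2 = inner x x
}.

#[short(type="hilbertType")]
HB.structure Definition Hilbert (R : realType) :=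
  {H of CompleteNormedModule R[i] H & CompleteNormedModule_isHilbert R H}.

Section BoundedOperators.
Variables (R : realType) (H : hilbertType R).

Definition bounded_op : {pred H -> H} :=
  fun f => `[< linear f /\ continuous f >].

Lemma bounded_opP (f : H -> H) :
  reflect (linear f /\ continuous f) (f \in bounded_op).
Proof. exact: asboolP. Qed.

Lemma bounded_op_submod : submod_closed bounded_op.
Proof.
split=> [|a f g /bounded_opP[lf cf] /bounded_opP[lg cg]]; apply/bounded_opP.
  split=> [b x y|x]; last exact: cst_continuous.
  by rewrite /GRing.zero/= scaler0 addr0.
split=> [b x y|x]; last first.
  by apply: cvgD; [apply: cvgZr; exact: cf|exact: cg].
have fE z : (a *: f + g) z = a *: f z + g z by [].
by rewrite !fE lf lg !scalerDr !scalerA [b * a]mulrC addrACA.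
Qed.

HB.instance Definition _ :=
  GRing.isSubmodClosed.Build R[i] (H -> H) bounded_op bounded_op_submod.

(* bop H is B(H); for linear maps, continuity amounts to boundedness. *)
Record bop := Bop { bop_fun :> H -> H; _ : bop_fun \in bounded_op }.

HB.instance Definition _ := [isSub for bop_fun].
HB.instance Definition _ := [Choice of bop by <:].
HB.instance Definition _ := [SubChoice_isSubLmodule of bop by <:].

Lemma bop_linear (T : bop) : linear T.
Proof. by have /bounded_opP[] := valP T. Qed.

Lemma bop_continuous (T : bop) : continuous T.
Proof. by have /bounded_opP[] := valP T. Qed.

HB.instance Definition _ (T : bop) :=
  GRing.isLinear.Build R[i] H H *:%R (bop_fun T) (bop_linear T).

Lemma bopP (S T : bop) : (forall x, S x = T x) -> S = T.
Proof. by move=> ST; apply/val_inj/funext. Qed.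

Lemma bopDE (S T : bop) x : (S + T) x = S x + T x. Proof. by []. Qed.

Lemma bopZE a (T : bop) x : (a *: T) x = a *: T x. Proof. by []. Qed.

Fact bop_one_subproof : (id : H -> H) \in bounded_op.
Proof. by apply/bounded_opP; split=> // x; exact: cvg_id. Qed.

Fact bop_mul_subproof (S T : bop) : S \o T \in bounded_op.
Proof.
apply/bounded_opP; split=> [a x y|x]; first by rewrite /= !linearP.
by apply: continuous_comp; exact: bop_continuous.
Qed.

Definition bop_one : bop := Bop bop_one_subproof.
Definition bop_mul (S T : bop) : bop := Bop (bop_mul_subproof S T).

Fact bop_mulA : associative bop_mul. Proof. by move=> S T U; exact: bopP. Qed.
Fact bop_mul1 : left_id bop_one bop_mul. Proof. by move=> T; exact: bopP. Qed.
Fact bop_1mul : right_id bop_one bop_mul. Proof. by move=> T; exact: bopP. Qed.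
Fact bop_mulDl : left_distributive bop_mul +%R.
Proof. by move=> S T U; exact: bopP. Qed.
Fact bop_mulDr : right_distributive bop_mul +%R.
Proof. by move=> S T U; apply: bopP => x; exact: (linearD S). Qed.

HB.instance Definition _ := GRing.Zmodule_isPzRing.Build bop
  bop_mulA bop_mul1 bop_1mul bop_mulDl bop_mulDr.

Definition opnorm (T : bop) : R :=
  sup [set complex.Re `|T x| | x in [set x : H | `|x| <= 1]].

Let normC_Re (x : H) : (complex.Re `|x|)%:C = `|x|.
Proof. by apply: RRe_real; rewrite ger0_real. Qed.

Let bop_bound (T : bop) : exists M : R, forall x, `|T x| <= M%:C * `|x|.
Proof.
have := (linear_bounded_continuous T).2 (@bop_continuous T).
move=> /linear_boundedP /pinfty_ex_gt0[M M0 TM].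
exists (complex.Re M) => x; rewrite RRe_real ?gtr0_real//; exact: TM.
Qed.

Let opnorm_has_sup (T : bop) :
  has_sup [set complex.Re `|T x| | x in [set x : H | `|x| <= 1]].
Proof.
split; first by exists (complex.Re `|T 0|), 0 => //=; rewrite normr0.
have [M TM] := bop_bound T; exists `|M| => _ [x x1 <-].
rewrite -lecR normC_Re (le_trans (TM x))//.
apply: (@le_trans _ _ (`|M|%:C * `|x|)).
  by rewrite ler_wpM2r// lecR ler_norm.
by rewrite ler_piMr// ler0c.
Qed.

Lemma ler_opnorm (T : bop) x : `|T x| <= (opnorm T)%:C * `|x|.
Proof.
have [->|x0] := eqVneq x 0; first by rewrite linear0 !normr0 mulr0.
have nx0 : 0 < `|x| by rewrite normr_gt0.
rewrite -ler_pdivrMr// mulrC -[X in X * _]ger0_norm ?invr_ge0//.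
rewrite -normrZ -linearZ -(normC_Re (T _)) lecR.
apply: sup_upper_bound; first exact: opnorm_has_sup.
by exists (`|x|^-1 *: x) => //=; rewrite normrZ normfV normr_id mulVf ?gt_eqF.
Qed.

Lemma opnorm_le (T : bop) (M : R) : 0 <= M ->
  (forall x, `|T x| <= M%:C * `|x|) -> opnorm T <= M.
Proof.
move=> M0 TM; apply: ge_sup; first exact: (opnorm_has_sup T).1.
move=> _ [x x1 <-]; rewrite -lecR normC_Re (le_trans (TM x))//.
by rewrite ler_piMr// ler0c.
Qed.

Lemma opnorm_ge0 (T : bop) : 0 <= opnorm T.
Proof.
apply: sup_upper_bound; first exact: opnorm_has_sup.
by exists 0 => /=; rewrite ?linear0 normr0.
Qed.

Fact opnormD (S T : bop) :
  (opnorm (S + T))%:C <= (opnorm S)%:C + (opnorm T)%:C.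
Proof.
rewrite -rmorphD lecR; apply: opnorm_le => [|x].
  by rewrite addr_ge0 ?opnorm_ge0.
rewrite bopDE (le_trans (ler_normD _ _))// rmorphD mulrDl.
by rewrite lerD ?ler_opnorm.
Qed.

Let opnormZ_le (a : R[i]) (T : bop) :
  opnorm (a *: T) <= complex.Re `|a| * opnorm T.
Proof.
have ra : (complex.Re `|a|)%:C = `|a| by apply: RRe_real; rewrite ger0_real.
apply: opnorm_le => [|x]; first by rewrite mulr_ge0 ?opnorm_ge0// -ler0c ra.
by rewrite bopZE normrZ rmorphM/= ra -mulrA ler_wpM2l ?ler_opnorm.
Qed.

Fact opnormZ (a : R[i]) (T : bop) :
  (opnorm (a *: T))%:C = `|a| * (opnorm T)%:C.
Proof.
have ra b : (complex.Re `|b : R[i]|)%:C = `|b|.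
  by apply: RRe_real; rewrite ger0_real.
have le b S : (opnorm (b *: S))%:C <= `|b| * (opnorm S)%:C.
  by rewrite -ra -rmorphM lecR opnormZ_le.
apply/eqP; rewrite eq_le le/=; have [->|a0] := eqVneq a 0.
  by rewrite normr0 mul0r lecR; exact: opnorm_ge0.
rewrite -ler_pdivlMl ?normr_gt0// -normfV (le_trans _ (le _ _))//.
by rewrite scalerA mulVf// scale1r.
Qed.

Fact opnorm_eq0 (T : bop) : (opnorm T)%:C = 0 -> T = 0.
Proof.
move=> T0; apply: bopP => x; apply/eqP; rewrite -normr_le0.
by rewrite (le_trans (ler_opnorm T x))// T0 mul0r.
Qed.

HB.instance Definition _ :=
  Lmodule_isNormed.Build R[i] bop opnormD opnormZ opnorm_eq0.

Lemma bop_normE (T : bop) : `|T| = (opnorm T)%:C. Proof. by []. Qed.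

(* Such an S exists and is unique by the Riesz representation theorem, so the
   default value 0 is never used. *)
Definition adj (T : bop) : bop :=
  xget 0 [set S : bop | forall x y, inner (T x) y = inner x (S y)].

End BoundedOperators.

Section CstarAlgebras.
Variables (R : realType) (H : hilbertType R).

Definition isometry_op (V : bop H) := forall x, `|V x| = `|x|.

Record cstar_subalgebra (A : set (bop H)) : Prop := CstarSubalgebra {
  cstar0 : A 0;
  cstarP : forall a S T, A S -> A T -> A (a *: S + T);
  cstarM : forall S T, A S -> A T -> A (S * T);
  cstarV : forall T, A T -> A (adj T);
  cstar_closed : closed A
}.

Definition cstar_generated (G : set (bop H)) : set (bop H) :=
  \bigcap_(A in [set A | cstar_subalgebra A /\ G `<=` A]) A.

Definition closed_subspace (M : set H) :=
  [/\ M 0, forall a x y, M x -> M y -> M (a *: x + y) & closed M].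

End CstarAlgebras.

(* A representation of A is encoded by a function on all of B(H); only its
   values on A matter. *)
Record representation (R : realType) (H K : hilbertType R) (A : set (bop H))
    (pi : bop H -> bop K) : Prop := Representation {
  reprP : forall a S T, A S -> A T -> pi (a *: S + T) = a *: pi S + pi T;
  reprM : forall S T, A S -> A T -> pi (S * T) = pi S * pi T;
  reprV : forall T, A T -> pi (adj T) = adj (pi T)
}.

Definition faithful (R : realType) (H K : hilbertType R) (A : set (bop H))
    (pi : bop H -> bop K) :=
  forall S T, A S -> A T -> pi S = pi T -> S = T.

(* The closed linear span of pi(A)K is K. *)
Definition nondegenerate (R : realType) (H K : hilbertType R)
    (A : set (bop H)) (pi : bop H -> bop K) :=
  forall M : set K, closed_subspace M ->
    (forall T x, A T -> M (pi T x)) -> M = setT.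

Section UCP.
Variables (R : realType) (K : hilbertType R).

(* T is positive as an operator on K^m, i.e. <T x, x> >= 0 for all x in K^m;
   in R[i], 0 <= z means that z is real and nonnegative. *)
Definition positive_opmx m (T : 'M[bop K]_m) :=
  forall x : 'I_m -> K, 0 <= \sum_i inner (\sum_j T i j (x j)) (x i).

Definition completely_positive (phi : bop K -> bop K) :=
  forall m (T : 'M[bop K]_m), positive_opmx T -> positive_opmx (map_mx phi T).

Definition UCP (phi : bop K -> bop K) :=
  [/\ linear phi, phi 1 = 1 & completely_positive phi].

End UCP.

(* A is a concrete C*-subalgebra of B(H) (every C*-algebra has this form), and
   need not act nondegenerately on H.  Since pi is faithful, pi(A) is the copy
   of A in B(K), and `countable` covers both finite and countably infinite. *)
Definition hyperrigid_generator (R : realType) (H : hilbertType R)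
    (A G : set (bop H)) :=
  [/\ countable G, cstar_generated G = A &
    forall (K : hilbertType R) (pi : bop H -> bop K),
      representation A pi -> faithful A pi -> nondegenerate A pi ->
    forall phi : nat -> bop K -> bop K, (forall k, UCP (phi k)) ->
      (forall g, G g -> opnorm (phi k (pi g) - pi g) @[k --> \oo] --> (0 : R)) ->
      forall a, A a -> opnorm (phi k (pi a) - pi a) @[k --> \oo] --> (0 : R)].

(* Main.v *)
(* Call [X] an asymptotic multiplier if [phi_k (X Y) - X phi_k Y] tends to 0 in
   norm for every [Y].  The asymptotic multipliers form a norm-closed algebra,
   so the [a] in A such that [pi a] and its adjoint are both asymptotic
   multipliers form a C*-algebra, because [pi] is bounded; taking [Y = 1] gives
   the convergence on A.  It remains to see that each [W_i = pi V_i] and its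
   adjoint are asymptotic multipliers.  By a Schwarz inequality for UCP maps,
   [X] is one as soon as [phi_k X] tends to [X] and the defect
   [phi_k (X X^* ) - phi_k X (phi_k X)^*] tends to 0.  For [X = W_i^*] this
   holds because [W_i^* W_i = 1].  For [X = W_i] the defects are positive, and
   their sum over [i] tends to 0 because [phi_k] converges on the sum of the
   [W_i W_i^*]. *)
Require Import Defs.
From HB Require Import structures.
From mathcomp Require Import all_boot all_order all_algebra.
From mathcomp Require Import complex.
From mathcomp Require Import all_classical reals topology normedtype.
From mathcomp Require Import ring lra.

Set Implicit Arguments.
Unset Strict Implicit.
Unset Printing Implicit Defensive.

Import Order.TTheory GRing.Theory Num.Theory.
Import numFieldNormedType.Exports.

Local Open Scope classical_set_scope.
Local Open Scope ring_scope.
Local Open Scope complex_scope.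

(** * Real-valued norms, closedness and limits in complex normed spaces *)

(** Stands in for letting [e] tend to 0: [C] collects the constants of an estimate, and dividing by
    [C + 1] covers [C = 0]. *)
Lemma le_eps (R : realType) (C x y : R) : 0 <= C ->
  (forall e, 0 < e -> x <= y + e * C) -> x <= y.
Proof.
move=> C0 h; apply/ler_addgt0Pr => e e0;
  have C1 : 0 < C + 1 by rewrite ltr_wpDl.
apply: le_trans (h (e / (C + 1)) _) _; first by rewrite divr_gt0.
by rewrite lerD2l mulrAC -mulrA ler_piMr ?(ltW e0)// ler_pdivrMr// mul1r lerDl.
Qed.

Section RealNorm.
Variables (R : realType) (V : normedModType R[i]).
Implicit Types x y : V.

(* [R[i]] is only partially ordered, so estimates go through the real-valued
   norm and the real part of the inner product, where [lra] and [nra] apply. *)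
Definition rnorm x : R := complex.Re `|x|.

Lemma rnormE x : (rnorm x)%:C = `|x|.
Proof. by apply: RRe_real; rewrite ger0_real. Qed.

Lemma rnorm_ge0 x : 0 <= rnorm x. Proof. by rewrite -ler0c rnormE. Qed.

Lemma rnormD x y : rnorm (x + y) <= rnorm x + rnorm y.
Proof. by rewrite -lecR rmorphD /= !rnormE ler_normD. Qed.

Lemma rnormN x : rnorm (- x) = rnorm x. Proof. by rewrite /rnorm normrN. Qed.

Lemma rnormZ (t : R) x : rnorm (t%:C *: x) = `|t| * rnorm x.
Proof.
by apply: complexI; rewrite rmorphM/= !rnormE normrZ normc_def/= expr0n addr0
  sqrtr_sqr.
Qed.

Lemma rnormZc (a : R[i]) x : rnorm (a *: x) = complex.Re `|a| * rnorm x.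
Proof.
by apply: complexI; rewrite rmorphM/= !rnormE normrZ.
Qed.

Lemma rnorm0 : rnorm (0 : V) = 0. Proof. by rewrite /rnorm normr0. Qed.

Lemma rnorm_eq0 x : rnorm x = 0 -> x = 0.
Proof. by move=> x0; apply/normr0_eq0; rewrite -rnormE x0. Qed.

Lemma rnormB x y : rnorm (x - y) = rnorm (y - x).
Proof. by rewrite /rnorm distrC. Qed.

Lemma rnorm_tri x y z : rnorm (x - z) <= rnorm (x - y) + rnorm (y - z).
Proof. by apply: le_trans (rnormD _ _); rewrite addrA subrK. Qed.

Lemma closed_adherent (M : set V) x : closed M ->
  (forall e : R, 0 < e -> exists2 y, M y & rnorm (x - y) < e) -> M x.
Proof.
move=> cM adh; apply: cM => B /nbhs_ballP[e e0 eB].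
have e0' : 0 < complex.Re e by rewrite -ltcR RRe_real ?gtr0_real.
have [y My xy] := adh _ e0'; exists y; split=> //; apply: eB.
by rewrite -ball_normE /ball_ /= -rnormE -[e]RRe_real ?gtr0_real// ltcR.
Qed.

Lemma closed_of_adherent (M : set V) :
  (forall x, (forall e : R, 0 < e -> exists2 y, M y & rnorm (x - y) < e) ->
     M x) ->
  closed M.
Proof.
move=> adh x clx; apply: adh => e e0.
have eC0 : 0 < e%:C by rewrite ltcR.
have [y [My xy]] := clx _ (nbhsx_ballx x _ eC0); exists y => //.
by move: xy; rewrite -ball_normE /ball_ /= -rnormE ltcR.
Qed.

End RealNorm.

Lemma complete_seq (R : realType) (V : completeNormedModType R[i])
    (u : nat -> V) :
  (forall e : R, 0 < e -> exists N, forall p q,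
     (N <= p)%N -> (N <= q)%N -> rnorm (u p - u q) < e) ->
  exists z, forall e : R, 0 < e -> exists N, forall p,
     (N <= p)%N -> rnorm (u p - z) < e.
Proof.
move=> cu.
have /cvg_ex[z uz] : cvg (u @ \oo).
  apply: cauchy_cvg; apply: cauchy_exP => e e0.
  have e0' : 0 < complex.Re e by rewrite -ltcR RRe_real ?gtr0_real.
  have [N uN] := cu _ e0'; exists (u N); exists N => // p /= Np.
  rewrite -ball_normE /ball_ /= -rnormE -[e]RRe_real ?gtr0_real// ltcR.
  exact: uN.
exists z => e e0.
have eC0 : 0 < e%:C by rewrite ltcR.
have [N _ uN] := (@cvgrPdist_lt _ V _ _ _ _ _).1 uz _ eC0.
exists N => p /uN; rewrite /= -rnormE ltcR rnormB; exact.
Qed.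

(** * The real part of the inner product *)

Section RealInner.
Variables (R : realType) (H : hilbertType R).
Implicit Types x y z : H.

Lemma innerC x y : inner x y = (inner y x)^*%C.
Proof. by rewrite hermC expr0 mul1r. Qed.

Definition rinner x y : R := complex.Re (inner x y).

Lemma rinnerC x y : rinner x y = rinner y x.
Proof. by rewrite /rinner innerC; case: (inner y x). Qed.

Lemma rinnerDl x y z : rinner (x + y) z = rinner x z + rinner y z.
Proof. by rewrite /rinner linearDl raddfD. Qed.

Lemma rinnerDr x y z : rinner x (y + z) = rinner x y + rinner x z.
Proof. by rewrite rinnerC rinnerDl !(rinnerC x). Qed.

Lemma rinnerNl x y : rinner (- x) y = - rinner x y.
Proof. by rewrite /rinner linearNl raddfN. Qed.

Lemma rinnerNr x y : rinner x (- y) = - rinner x y.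
Proof. by rewrite rinnerC rinnerNl rinnerC. Qed.

Lemma rinner0l x : rinner 0 x = 0.
Proof. by rewrite /rinner linear0l. Qed.

Lemma rinnerZl (t : R) x y : rinner (t%:C *: x) y = t * rinner x y.
Proof. by rewrite /rinner linearZl_LR/=; case: (inner x y) => a b; simpc. Qed.

Lemma rinnerZr (t : R) x y : rinner x (t%:C *: y) = t * rinner x y.
Proof. by rewrite rinnerC rinnerZl rinnerC. Qed.

Lemma rinner_iZl x y : rinner ('i *: x) y = - complex.Im (inner x y).
Proof. by rewrite /rinner linearZl_LR/=; case: (inner x y) => a b; simpc. Qed.

Lemma rinner_rnorm x : rinner x x = rnorm x ^+ 2.
Proof.
apply: complexI; rewrite rmorphXn/= rnormE sqr_norm_inner RRe_real//.
by rewrite -sqr_norm_inner ger0_real// exprn_ge0.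
Qed.

(** The scalar [1] compares the real parts and ['i] the imaginary parts. *)
Lemma inner_rinner x y z w :
  (forall a : R[i], rinner (a *: x) y = rinner (a *: z) w) ->
  inner x y = inner z w.
Proof.
move=> h; have /eqP := h 'i; have := h 1; rewrite !rinner_iZl !scale1r eqr_opp.
by rewrite /rinner; case: (inner x y) (inner z w) => a b [c d] /= -> /eqP ->.
Qed.

Lemma rinner_inj y z : (forall x, rinner x y = rinner x z) -> y = z.
Proof.
move=> h; apply/eqP; rewrite -subr_eq0; apply/eqP/rnorm_eq0/eqP.
by rewrite -sqrf_eq0 -rinner_rnorm rinnerDr rinnerNr h subrr.
Qed.

Lemma rnormD2 x y :
  rnorm (x + y) ^+ 2 = rnorm x ^+ 2 + 2 * rinner x y + rnorm y ^+ 2.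
Proof. by rewrite -!rinner_rnorm rinnerDl !rinnerDr (rinnerC y x); ring. Qed.

(** The triangle inequality comes with the norm, so squaring and expanding it gives
    Cauchy-Schwarz. *)
Lemma rinner_le x y : rinner x y <= rnorm x * rnorm y.
Proof.
have := rnormD x y; rewrite -(ler_pXn2r (ltn0Sn 1)) ?nnegrE ?addr_ge0
  ?rnorm_ge0//.
by rewrite rnormD2; nra.
Qed.

End RealInner.

(** * Riesz representation of bounded real-linear functionals *)

Section Riesz.
Variables (R : realType) (H : hilbertType R).
Variables (f : H -> R) (M : R).
Hypotheses (fD : forall x y, f (x + y) = f x + f y)
  (fZ : forall (t : R) x, f (t%:C *: x) = t * f x)
  (fM : forall x, f x <= M * rnorm x).

Let J x := rnorm x ^+ 2 - 2 * f x.

Let JV x h t : J (x + t%:C *: h) =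
  J x + 2 * t * (rinner x h - f h) + t ^+ 2 * rnorm h ^+ 2.
Proof.
by rewrite /J rnormD2 fD fZ rinnerZr rnormZ exprMn real_normK ?num_real//; ring.
Qed.

Let Jinf : has_inf (range J).
Proof.
split; first by exists (J 0), 0.
exists (- M ^+ 2) => _ [x _ <-]; rewrite /J.
by have := fM x; have := sqr_ge0 (rnorm x - M); nra.
Qed.

Let m := inf (range J).

Let m_le x : m <= J x. Proof. by apply: ge_inf; [exact: Jinf.2|exists x]. Qed.

(** Compare [m] with [J] at the midpoint of [x] and [y]; expanding [J x] around [y] eliminates the
    linear term. *)
Let J_half x y : rnorm (x - y) ^+ 2 <= 2 * (J x - m) + 2 * (J y - m).
Proof.
have := m_le (y + (2^-1)%:C *: (x - y)); rewrite JV.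
by have := JV y (x - y) 1; rewrite scale1r [y + _]addrC subrK; lra.
Qed.

(* An almost minimizing sequence of [|x|^2 - 2 f x] is Cauchy by the
   parallelogram law; first variation at its limit gives the representation. *)
Lemma riesz : exists z, forall x, f x = rinner x z.
Proof.
have app (k : nat) : exists x, J x < m + k.+1%:R^-1.
  have k0 : 0 < k.+1%:R^-1 :> R by rewrite invr_gt0.
  have [_ [x _ <-] ?] := inf_adherent k0 Jinf.
  by exists x.
have [u Ju] := choice app; have {}Ju k : J (u k) < m + k.+1%:R^-1 by exact: Ju.
have inv_small (e : R) :
    0 < e -> exists N, forall p, (N <= p)%N -> p.+1%:R^-1 < e.
  move=> e0; exists (Num.truncn e^-1) => p Np.
  rewrite invf_plt ?posrE// (lt_le_trans (truncnS_gt _))// ler_nat ltnS//.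
have [e e0|z uz] := @complete_seq R H u.
  (* By [J_half], [|u p - u q|^2] is below [2 / p.+1 + 2 / q.+1], so both reciprocals have to be
     below a quarter of [e ^+ 2]. *)
  have [N hN] := inv_small (e ^+ 2 / 4) ltac:(by rewrite divr_gt0// exprn_gt0).
  exists N => p q /hN hp /hN hq.
  rewrite -(ltr_pXn2r (ltn0Sn 1)) ?nnegrE ?rnorm_ge0 ?(ltW e0)//.
  move: hp hq (J_half (u p) (u q)) (Ju p) (Ju q).
  by move: (J (u p)) (J (u q)) (p.+1%:R^-1) (q.+1%:R^-1) => a b c d; lra.
exists z => h; rewrite rinnerC; apply/eqP; rewrite eq_sym -subr_eq0; apply/eqP.
set d := rinner z h - f h.
(* Expansion of [m <= J (u p + t h)]: the first [e] pays for [J (u p) < m + e], the last term for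
   replacing [u p] by the limit [z]. *)
have key t e : 0 < e ->
    0 <= e + 2 * t * d + t ^+ 2 * rnorm h ^+ 2 + e * (2 * `|t| * rnorm h).
  move=> e0; have [N hN] := inv_small _ e0; have [N' hN'] := uz _ e0.
  pose p := maxn N N'.
  have hp := hN p (leq_maxl _ _); have hp' := hN' p (leq_maxr _ _).
  have := m_le (u p + t%:C *: h); rewrite JV; have := Ju p.
  have : t * (rinner (u p) h - f h) <= t * d + e * (`|t| * rnorm h).
    rewrite -lerBlDl -mulrBr /d opprB addrA subrK -rinnerNl -rinnerDl.
    rewrite -rinnerZr (le_trans (rinner_le _ _))// rnormZ ler_wpM2r ?mulr_ge0
      ?rnorm_ge0//.
    exact: ltW.
  move: hp; move: (J (u p)) (p.+1%:R^-1) (rinner (u p) h - f h) => a b c.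
  by lra.
have key' t : 0 <= 2 * t * d + t ^+ 2 * rnorm h ^+ 2.
  apply: (@le_eps _ (1 + 2 * `|t| * rnorm h)) => [|e e0].
    by rewrite addr_ge0// !mulr_ge0// rnorm_ge0.
  by have := key t _ e0; lra.
set q := rnorm h ^+ 2 in key'; have q0 : 0 <= q by exact: sqr_ge0.
have q1 : q + 1 != 0 by rewrite gt_eqF// ltr_wpDl.
(* Nearly the minimizing [t]; the [+ 1] keeps the denominator nonzero when [h = 0]. The value is a
   negative multiple of [d ^+ 2], which forces [d = 0]. *)
have := key' (- d / (q + 1)).
have -> : 2 * (- d / (q + 1)) * d + (- d / (q + 1)) ^+ 2 * q =
  - (d ^+ 2 * ((q + 2) / (q + 1) ^+ 2)) by field.
rewrite oppr_ge0 pmulr_lle0; last first.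
  by rewrite divr_gt0 ?exprn_gt0 ?ltr_wpDl.
by rewrite real_exprn_even_le0 ?num_real// => /eqP.
Qed.

End Riesz.

(** * Bounded operators: norm, adjoint and completeness *)

Section BoundedOperatorTheory.
Variables (R : realType) (H : hilbertType R).
Implicit Types (S T : bop H) (x y z : H).

Lemma rnorm_app T x : rnorm (T x) <= rnorm T * rnorm x.
Proof. by rewrite -lecR rmorphM /= !rnormE; exact: ler_opnorm. Qed.

Lemma rnorm_op_le T (M : R) : 0 <= M ->
  (forall x, rnorm (T x) <= M * rnorm x) -> rnorm T <= M.
Proof.
move=> M0 TM; apply: opnorm_le => // x.
by rewrite -!rnormE -rmorphM lecR.
Qed.

Lemma bop_mulE S T x : (S * T) x = S (T x). Proof. by []. Qed.

Lemma bop_oneE x : (1 : bop H) x = x. Proof. by []. Qed.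

Lemma bop_oppE T x : (- T) x = - T x. Proof. by []. Qed.

Lemma rnormM S T : rnorm (S * T) <= rnorm S * rnorm T.
Proof.
apply: rnorm_op_le => [|x]; first by rewrite mulr_ge0 ?rnorm_ge0.
rewrite bop_mulE (le_trans (rnorm_app _ _))// -mulrA ler_wpM2l ?rnorm_ge0//.
exact: rnorm_app.
Qed.

Lemma bop_of_bound (f : H -> H) (M : R) : linear f ->
  (forall x, rnorm (f x) <= M * rnorm x) ->
  exists T : bop H, forall x, T x = f x.
Proof.
move=> lf fM; pose F := GRing.isLinear.Build R[i] H H *:%R f lf.
pose g : {linear H -> H} := HB.pack f F.
have cf : continuous f.
  apply: (linear_bounded_continuous g).1; apply/linear_boundedP.
  exists `|M|%:C; split; first by rewrite ger0_real// ler0c.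
  move=> r Mr x; apply: le_trans (ler_wpM2r _ (ltW Mr)) => //.
  rewrite -!rnormE -rmorphM lecR (le_trans (fM x))//.
  by rewrite ler_wpM2r ?rnorm_ge0 ?ler_norm.
have fb : f \in bounded_op (H := H) by apply/bounded_opP.
by exists (Bop fb).
Qed.

Lemma rinner_conj (a : R[i]) x y : rinner (a *: x) y = rinner x (a^*%C *: y).
Proof. by rewrite /rinner linearZl_LR linearZr_LR/= conjCK. Qed.

(** Test the relation at [x = S y] and cancel one factor [|S y|]. [S] is a bare function because
    this bound is what makes the Riesz adjoint an element of [bop H]. *)
Lemma adjoint_bound T (S : H -> H) y :
  (forall x, rinner (T x) y = rinner x (S y)) ->
  rnorm (S y) <= rnorm T * rnorm y.
Proof.
move=> TS; have := rinner_le (T (S y)) y; rewrite TS rinner_rnorm.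
have := rnorm_app T (S y); have := rnorm_ge0 (S y); have := rnorm_ge0 y.
have := rnorm_ge0 T.
move: (rnorm (T _)) (rnorm T) (rnorm y) (rnorm (S y)) => a b c d *.
have [->|d0] := eqVneq d 0; first by rewrite mulr_ge0.
have : d * d <= d * (b * c) by nra.
by rewrite ler_pM2l// lt_def d0.
Qed.

(** Riesz applies to [rinner (T x) y] for each [y]. Since [T] commutes with complex scalars, the
    real identity at all multiples of [x] gives both the linearity of [S] and the complex
    identity. *)
Lemma adj_exists T :
  exists S : bop H, forall x y, inner (T x) y = inner x (S y).
Proof.
have /choice[S TS] y : exists z, forall x, rinner (T x) y = rinner x z.
  apply: (@riesz R H (fun x => rinner (T x) y) (rnorm T * rnorm y))
    => [x x'|t x|x].
  - by rewrite linearD rinnerDl.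
  - by rewrite linearZ rinnerZl.
  - rewrite mulrAC (le_trans (rinner_le _ _))// ler_wpM2r ?rnorm_ge0//.
    exact: rnorm_app.
have lS : linear S.
  move=> a y y'; apply: rinner_inj => x.
  by rewrite -TS !rinnerDr -TS -[a]conjcK -!rinner_conj -TS linearZ.
have [y|S' SS'] := bop_of_bound (M := rnorm T) lS; first exact: adjoint_bound.
exists S' => x y; rewrite SS'; apply: inner_rinner => a.
by rewrite -linearZ TS.
Qed.

Lemma adjP T x y : inner (T x) y = inner x (adj T y).
Proof. by have := xgetPex 0 (adj_exists T); apply. Qed.

Lemma rinner_adj T x y : rinner (T x) y = rinner x (adj T y).
Proof. by rewrite /rinner adjP. Qed.

Lemma rinner_adjl T x y : rinner (adj T x) y = rinner x (T y).
Proof. by rewrite rinnerC -rinner_adj rinnerC. Qed.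

Lemma adj_unique T S : (forall x y, rinner (T x) y = rinner x (S y)) ->
  adj T = S.
Proof.
by move=> TS; apply: bopP => y; apply: rinner_inj => x; rewrite -rinner_adj.
Qed.

Lemma bop_adjK T : adj (adj T) = T.
Proof. by apply: adj_unique => x y; rewrite rinner_adjl. Qed.

Lemma bop_adj1 : adj 1 = 1 :> bop H.
Proof. exact: adj_unique. Qed.

Lemma bop_adjM S T : adj (S * T) = adj T * adj S.
Proof. by apply: adj_unique => x y; rewrite !bop_mulE !rinner_adj. Qed.

Lemma bop_adjD S T : adj (S + T) = adj S + adj T.
Proof.
by apply: adj_unique => x y; rewrite !bopDE rinnerDl rinnerDr !rinner_adj.
Qed.

Lemma bop_adjZ a T : adj (a *: T) = a^*%C *: adj T.
Proof.
by apply: adj_unique => x y; rewrite !bopZE rinner_conj rinner_adj linearZ.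
Qed.

Lemma bop_adj0 : adj 0 = 0 :> bop H.
Proof. by rewrite -(scale0r (0 : bop H)) bop_adjZ rmorph0 !scale0r. Qed.

Lemma bop_adjN T : adj (- T) = - adj T.
Proof.
by apply: adj_unique => x y; rewrite !bop_oppE rinnerNl rinnerNr rinner_adj.
Qed.

Lemma rnorm_adj T : rnorm (adj T) <= rnorm T.
Proof.
apply: rnorm_op_le => [|y]; first exact: rnorm_ge0.
by apply: adjoint_bound => x; exact: rinner_adj.
Qed.

(** Polarization: preserving the norms of [x], [y] and [x + y] preserves [rinner x y]. *)
Lemma isometry_adjM T : isometry_op T -> adj T * T = 1.
Proof.
move=> isoT; have nT x : rnorm (T x) = rnorm x by rewrite /rnorm isoT.
apply: bopP => y; apply: rinner_inj => x; rewrite bop_mulE -rinner_adj bop_oneE.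
have := rnormD2 (T x) (T y); rewrite -linearD !nT rnormD2.
by move=> /addIr/addrI/mulfI->//; rewrite pnatr_eq0.
Qed.

(** Pointwise limits exist by completeness of [H]. The Cauchy bound passes to the limit as an error
    of at most [e * |x|], from which linearity, boundedness and norm convergence follow. *)
Lemma complete_bop (u : nat -> bop H) :
  (forall e : R, 0 < e -> exists N, forall p q,
     (N <= p)%N -> (N <= q)%N -> rnorm (u p - u q) < e) ->
  exists T, forall e : R, 0 < e -> exists N, forall p,
     (N <= p)%N -> rnorm (u p - T) < e.
Proof.
move=> cu.
have /choice[f uf] x : exists z, forall e : R, 0 < e ->
    exists N, forall p, (N <= p)%N -> rnorm (u p x - z) < e.
  apply: (complete_seq (u := fun p => u p x)) => e e0.
  have x1 : 0 < rnorm x + 1 by rewrite ltr_wpDl ?rnorm_ge0.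
  have [N uN] := cu (e / (rnorm x + 1)) ltac:(by rewrite divr_gt0).
  exists N => p q Np Nq; have := uN p q Np Nq; rewrite ltr_pdivlMr//.
  by apply: le_lt_trans;
    rewrite (le_trans (rnorm_app (_ - _) _))// ler_wpM2l ?rnorm_ge0 ?lerDl.
have close e : 0 < e -> exists N, forall p, (N <= p)%N ->
    forall x, rnorm (u p x - f x) <= e * rnorm x.
  move=> e0; have [N uN] := cu e e0; exists N => p Np x.
  apply: (@le_eps _ 1) => // d d0; have [N' uN'] := uf x d d0.
  pose q := maxn N N'; rewrite mulr1.
  apply: le_trans (rnorm_tri _ (u q x) _) _; rewrite lerD//; last first.
    by rewrite ltW// uN' ?leq_maxr.
  apply: le_trans (rnorm_app (u p - u q) x) _.
  by rewrite ler_wpM2r ?rnorm_ge0// ltW// uN// leq_maxl.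
have lf : linear f.
  move=> a x y; apply/eqP; rewrite -subr_eq0; apply/eqP/rnorm_eq0/le_anti.
  rewrite rnorm_ge0 andbT.
  apply: (@le_eps _ (rnorm (a *: x + y) + complex.Re `|a| * rnorm x + rnorm y))
    => [|e e0].
    by rewrite !addr_ge0 ?mulr_ge0 ?rnorm_ge0//; exact: (@rnorm_ge0 _ R[i]^o).
  have [N uN] := close e e0; have uNx z := uN N (leqnn N) z.
  have -> : f (a *: x + y) - (a *: f x + f y) =
     (f (a *: x + y) - u N (a *: x + y)) + a *: (u N x - f x) + (u N y - f y).
    rewrite (bop_linear (u N)) scalerBr -addrA [X in _ = _ + X]addrACA -opprD.
    by rewrite [RHS]addrA subrK.
  rewrite add0r !mulrDr (le_trans (rnormD _ _))// lerD//.
  rewrite (le_trans (rnormD _ _))// lerD//; first by rewrite rnormB.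
  by rewrite rnormZc mulrCA ler_wpM2l//; exact: (@rnorm_ge0 _ R[i]^o).
have [N uN] := close 1 ltr01.
have [x|T Tf] := bop_of_bound (M := 1 + rnorm (u N)) lf.
  rewrite -[f x](subrK (u N x)) mulrDl (le_trans (rnormD _ _))// lerD
    ?rnorm_app//.
  by rewrite rnormB uN.
exists T => e e0; have [N' uN'] := close (e / 2) ltac:(by rewrite divr_gt0).
exists N' => p /uN' up; apply: (@le_lt_trans _ _ (e / 2)); last by lra.
by apply: rnorm_op_le => [|x]; [lra|have := up x; rewrite -Tf].
Qed.

End BoundedOperatorTheory.

(** * Square roots inside a C*-subalgebra *)

Lemma expr_half_small (R : realType) (e : R) : 0 < e ->
  exists N, 2^-1 ^+ N < e.
Proof.
move=> e0; exists (Num.truncn e^-1);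
  rewrite exprVn invf_plt ?posrE ?exprn_gt0//.
by rewrite (lt_le_trans (truncnS_gt _))// -natrX ler_nat ltn_expl.
Qed.

Section CstarSubalgebras.
Variables (R : realType) (H : hilbertType R) (A : set (bop H)).
Hypothesis cA : cstar_subalgebra A.

Lemma cstarD S T : A S -> A T -> A (S + T).
Proof. by move=> AS AT; rewrite -[S]scale1r; apply: cstarP. Qed.

Lemma cstarZ a S : A S -> A (a *: S).
Proof.
by move=> AS; rewrite -[_ *: _]addr0; apply: cstarP => //; exact: cstar0.
Qed.

Lemma cstar_sum n (V : 'I_n -> bop H) : (forall i, A (V i)) -> A (\sum_i V i).
Proof.
by move=> AV; apply: big_ind => //; [exact: cstar0|exact: cstarD].
Qed.

(* With [y = 1 - sqrt (1 - h)] this is [(1 - y) ^ 2 = 1 - h], stated so as not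
   to need a unit in [A].  Iterate the contraction [y |-> (h + y * y) / 2]. *)
Lemma half_square_root h : A h -> adj h = h -> rnorm h <= 3 / 4 ->
  exists y, [/\ A y, adj y = y & y + y = h + y * y].
Proof.
move=> Ah adjh nh.
pose u := fix u n : bop H :=
  if n is k.+1 then (2^-1)%:C *: (h + u k * u k) else 0.
have uS n : u n.+1 = (2^-1)%:C *: (h + u n * u n) by [].
have Au n : A (u n).
  elim: n => [|n IH]; first exact: cstar0.
  by rewrite uS; apply/cstarZ/cstarD => //; exact: cstarM.
have adju n : adj (u n) = u n.
  elim: n => [|n IH]; first exact: bop_adj0.
  by rewrite uS bop_adjZ bop_adjD bop_adjM IH adjh conjc_real.
have half0 : 0 <= 2^-1 :> R by rewrite invr_ge0.
(* The ball of radius 1/2 is invariant because [(3 / 4 + 1 / 4) / 2 = 1 / 2]. Squaring is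
   1-Lipschitz on it, so the halved map contracts by 1/2. *)
have nu n : rnorm (u n) <= 2^-1.
  elim: n => [|n IH]; first by rewrite rnorm0.
  rewrite uS rnormZ ger0_norm//; have := rnormD h (u n * u n);
    have := rnormM (u n) (u n).
  by have := rnorm_ge0 (u n); nra.
have sqB (S T : bop H) : S * S - T * T = S * (S - T) + (S - T) * T.
  by rewrite mulrBr mulrBl addrA subrK.
have nsq n (T : bop H) : rnorm T <= 2^-1 ->
    rnorm (u n * u n - T * T) <= rnorm (u n - T).
  move=> nT; rewrite sqB (le_trans (rnormD _ _))//.
  have := rnormM (u n) (u n - T); have := rnormM (u n - T) T;
    have := rnorm_ge0 (u n - T).
  by have := nu n; nra.
have du n : rnorm (u n.+1 - u n) <= 2^-1 ^+ n.
  elim: n => [|n IH]; first by rewrite subr0 (le_trans (nu _))//; lra.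
  rewrite uS [u n.+1 in X in _ - X]uS -scalerBr opprD addrACA subrr add0r
    rnormZ.
  by rewrite ger0_norm// exprS ler_wpM2l// (le_trans (nsq _ _ (nu _))).
(* The subtracted term is the unspent remainder of the geometric series; keeping it makes the
   induction close. *)
have tail n k :
    rnorm (u (n + k)%N - u n) <= 2 * 2^-1 ^+ n - 2^-1 ^+ (n + k) * 2.
  elim: k => [|k IH]; first by rewrite addn0 subrr rnorm0 mulrC subrr.
  rewrite addnS (le_trans (rnorm_tri _ (u (n + k)%N) _))//.
  by have := du (n + k)%N; rewrite exprS; lra.
have [e e0|y uy] := complete_bop (u := u).
  have [N hN] := expr_half_small (ltac:(lra) : 0 < e / 4).
  exists N => p q /subnKC <- /subnKC <-.
  apply: le_lt_trans (rnorm_tri _ (u N) _) _; rewrite [X in _ + X]rnormB.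
  have := tail N (p - N)%N; have := tail N (q - N)%N.
  have := exprn_ge0 (N + (p - N))%N half0.
  have := exprn_ge0 (N + (q - N))%N half0; lra.
have ny : rnorm y <= 2^-1.
  apply: (@le_eps _ 1) => // e e0; have [N uN] := uy e e0.
  have := rnorm_tri y (u N) 0; rewrite !subr0 rnormB.
  by have := uN N (leqnn _); have := nu N; lra.
exists y; split.
- apply: (closed_adherent (cstar_closed cA)) => e /uy[N uN].
  by exists (u N) => //; rewrite rnormB uN.
- apply/eqP; rewrite -subr_eq0; apply/eqP/rnorm_eq0/le_anti;
    rewrite rnorm_ge0 andbT.
  apply: (@le_eps _ 2) => // e e0; have [N uN] := uy e e0.
  apply: le_trans (rnorm_tri _ (u N) _) _; have := uN N (leqnn _).
  rewrite -{2}[u N]adju -bop_adjN -bop_adjD; have := rnorm_adj (y - u N).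
  by rewrite rnormB; lra.
apply/eqP; rewrite -subr_eq0; apply/eqP/rnorm_eq0/le_anti;
  rewrite rnorm_ge0 andbT.
(* An error [2 * e] comes from replacing [y + y] by [u N.+1 + u N.+1 = h + u N * u N], and one more
   [e] from the squares. *)
apply: (@le_eps _ 3) => // e e0; have [N uN] := uy e e0.
have e1 := uN N (leqnn _); have e2 := uN N.+1 (leqnSn _).
have -> : y + y - (h + y * y) =
  (y + y - (u N.+1 + u N.+1)) + (u N * u N - y * y).
  rewrite uS -scalerDl -rmorphD /=.
  have -> : 2^-1 + 2^-1 = 1 :> R by lra.
  by rewrite scale1r !opprD -[RHS]addrA [X in _ = _ + X]addrA subrK.
apply: le_trans (rnormD _ _) _; rewrite add0r opprD addrACA.
have := rnormD (y - u N.+1) (y - u N.+1); rewrite rnormB.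
have := nsq N _ ny; lra.
Qed.

End CstarSubalgebras.

(** * Automatic boundedness of representations *)

Lemma representationD (R : realType) (H K : hilbertType R) (A : set (bop H))
    (pi : bop H -> bop K) : representation A pi ->
  forall S T, A S -> A T -> pi (S + T) = pi S + pi T.
Proof.
by move=> rpi S T AS AT; have := reprP rpi 1 AS AT; rewrite !scale1r.
Qed.

Lemma representation0 (R : realType) (H K : hilbertType R) (A : set (bop H))
    (pi : bop H -> bop K) : A 0 -> representation A pi -> pi 0 = 0.
Proof.
move=> A0 rpi; have := representationD rpi A0 A0.
by rewrite addr0 -{1}[pi 0]addr0 => /addrI.
Qed.

(** For [|a| <= 1 / 2], applying [pi] to [y + y = adj a * a + y * y] gives
    [|pi a x|^2 = |x|^2 - |x - pi y x|^2], hence [|pi a| <= 1]. Rescaling by [1 / (2 |a|)] produces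
    the constant 2, which is not sharp but suffices for continuity. *)
Lemma representation_le2 (R : realType) (H K : hilbertType R) (A : set (bop H))
    (pi : bop H -> bop K) : cstar_subalgebra A -> representation A pi ->
  forall a, A a -> rnorm (pi a) <= 2 * rnorm a.
Proof.
move=> cA rpi.
have piD := representationD rpi.
have pi0 := representation0 (cstar0 cA) rpi.
have small a : A a -> rnorm a <= 2^-1 -> rnorm (pi a) <= 1.
  move=> Aa na; have Aa' := cstarV cA Aa.
  have Ah := cstarM cA Aa' Aa.
  have [||y [Ay adjy yE]] := half_square_root cA Ah.
  - by rewrite bop_adjM bop_adjK.
  - have := rnormM (adj a) a; have := rnorm_adj a; have := rnorm_ge0 a.
    by have := rnorm_ge0 (adj a); nra.
  have := congr1 pi yE; rewrite !piD ?(reprM rpi) ?(reprV rpi)//;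
    last exact: cstarM.
  set p := pi y => pE; have pa : adj p = p by rewrite -(reprV rpi) ?adjy.
  apply: rnorm_op_le => // x;
    rewrite mul1r -(ler_pXn2r (ltn0Sn 1)) ?nnegrE ?rnorm_ge0//.
  have := congr1 (fun T : bop K => rinner (T x) x) pE.
  rewrite !bopDE !bop_mulE !rinnerDl rinner_adjl (rinner_adj p (p x)) pa
    !rinner_rnorm.
  have := sqr_ge0 (rnorm (x - p x));
    rewrite rnormD2 rinnerNr rnormN (rinnerC x).
  lra.
move=> a Aa; have [a0|a0] := eqVneq (rnorm a) 0.
  by rewrite (rnorm_eq0 a0) pi0 rnorm0 rnorm0 mulr0.
have na : 0 < rnorm a by rewrite lt_def a0 rnorm_ge0.
pose t := (2 * rnorm a)^-1.
have := small (t%:C *: a) (cstarZ cA _ Aa); rewrite rnormZ.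
have t0 : 0 < t by rewrite invr_gt0 mulr_gt0.
rewrite gtr0_norm//.
have -> : pi (t%:C *: a) = t%:C *: pi a.
  by have := reprP rpi t%:C Aa (cstar0 cA); rewrite pi0 !addr0.
rewrite rnormZ gtr0_norm// [t * rnorm a]mulrC [t * rnorm (pi a)]mulrC /t => h.
rewrite -[2 * _]mul1r -ler_pdivrMr ?mulr_gt0//; apply: h.
by rewrite invfM mulrCA mulfV ?gt_eqF// mulr1.
Qed.

(** * Schwarz inequalities for UCP maps *)

Section UCPSchwarz.
Variables (R : realType) (K : hilbertType R) (phi : bop K -> bop K).
Hypothesis Uphi : UCP phi.
Implicit Types (S T X Y : bop K) (x y z : K).

Lemma UCP_linear : linear phi. Proof. by case: Uphi. Qed.

Lemma UCP1 : phi 1 = 1. Proof. by case: Uphi. Qed.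

Lemma UCPB S T : phi (S - T) = phi S - phi T.
Proof. by rewrite [S - T]addrC -[- T]scaleN1r UCP_linear scaleN1r addrC. Qed.

Lemma UCPD S T : phi (S + T) = phi S + phi T.
Proof. by rewrite -{1}[S]scale1r UCP_linear scale1r. Qed.

Lemma UCP0 : phi 0 = 0.
Proof. by have := UCPB 0 0; rewrite !subrr. Qed.

Lemma UCPZ a T : phi (a *: T) = a *: phi T.
Proof. by rewrite -{1}[a *: T]addr0 UCP_linear UCP0 addr0. Qed.

Lemma UCP_sum n (T : 'I_n -> bop K) : phi (\sum_i T i) = \sum_i phi (T i).
Proof. exact: (big_morph phi UCPD UCP0). Qed.

(** The matrix of the [A i * adj (A j)] is positive: its form at [x] is the squared norm of the sum
    of the [adj (A j) (x j)]. *)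
Lemma UCP_gram m (A : 'I_m -> bop K) (x : 'I_m -> K) :
  0 <= \sum_i \sum_j inner (phi (A i * adj (A j)) (x j)) (x i).
Proof.
have [_ _ cp] := Uphi.
have := cp m (\matrix_(i, j) (A i * adj (A j))) _ x.
under eq_bigr do (rewrite linear_sumlz; under eq_bigr do rewrite !mxE).
apply=> {}x; pose w := \sum_j adj (A j) (x j).
rewrite (_ : \sum_i _ = inner w w) ?dnorm_ge0//.
rewrite {2}/w linear_sumr; apply: eq_bigr => i _.
transitivity (inner (A i w) (x i)); last exact: adjP.
congr (inner _ _); rewrite linear_sum.
by apply: eq_bigr => j _; rewrite mxE.
Qed.

(** The Gram form of the column [[X; 1]] is real. Subtracting its values at [y = 0] and at [x = 0]
    leaves real cross terms, and replacing [y] by ['i *: y] turns this into equality of real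
    parts. *)
Lemma UCP_adj X : phi (adj X) = adj (phi X).
Proof.
symmetry; apply: adj_unique => y x.
pose Q x y := inner (phi (X * adj X) x) x + inner (phi X y) x +
  (inner (phi (adj X) x) y + inner y y).
have ImQ x' y' : complex.Im (Q x' y') = 0.
  have := UCP_gram (fun i : 'I_2 => nth 0 [:: X; 1] i)
    (fun i => nth 0 [:: x'; y'] i).
  rewrite !big_ord_recl !big_ord0 /= !addr0 bop_adj1 !mulr1 mul1r UCP1
    -/(Q x' y').
  by case: (Q x' y') => a b; rewrite lecE => /andP[/eqP].
have Im0 x' y' :
    complex.Im (inner (phi X y') x' + inner (phi (adj X) x') y') = 0.
  have := ImQ x' y'; have := ImQ x' 0; have := ImQ 0 y'; rewrite /Q.
  rewrite !linear0 ?linear0l ?linear0r !addr0 !add0r => h1 h2.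
  move: h1 h2; rewrite !raddfD /=; lra.
have := Im0 x ('i *: y); rewrite linearZ linearZl_LR linearZr_LR /rinner /=.
rewrite [inner y _]innerC.
by case: (inner _ _) (inner _ _) => a b [c d]; simpc => /=; lra.
Qed.

(** Complete positivity for 1 by 1 matrices, applied to the positive operator
    [|Y|^2 - adj Y * Y]. *)
Lemma UCP_sqr_le Y y :
  rinner (phi (adj Y * Y) y) y <= rnorm Y ^+ 2 * rnorm y ^+ 2.
Proof.
have [_ _ cp] := Uphi;
  pose T : bop K := (rnorm Y ^+ 2)%:C *: (1 : bop K) - adj Y * Y.
have : 0 <= \sum_(i < 1) inner (\sum_(j < 1) map_mx phi (const_mx T) i j y) y.
  apply: (cp 1%N (const_mx T) _ (fun=> y)) => x; rewrite !big_ord1 mxE.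
  move: (x ord0) => {}x; rewrite bopDE bopZE bop_oppE bop_mulE.
  rewrite linearBl linearZl_LR/= [inner (adj Y _) _]innerC -adjP
    -sqr_norm_inner.
  rewrite -sqr_norm_inner -!rnormE -!rmorphXn -rmorphM conjc_real -rmorphB/=
    ler0c.
  by rewrite subr_ge0 -exprMn ler_pXn2r ?nnegrE ?mulr_ge0 ?rnorm_ge0//
    rnorm_app.
rewrite !big_ord1 !mxE /T UCPB UCPZ UCP1 => h.
have : 0 <= rinner (((rnorm Y ^+ 2)%:C *: (1 : bop K) - phi (adj Y * Y)) y) y.
  by move: h; rewrite /rinner; case: (inner _ _) => a b;
    rewrite lecE => /andP[].
by rewrite bopDE bopZE bop_oppE rinnerDl rinnerNl rinnerZl rinner_rnorm
  subr_ge0.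
Qed.

(* Complete positivity for the Gram matrix of the column [X; adj Y; 1],
   evaluated at [(x, y, z)] with the [z] minimizing the form. *)
Lemma UCP_schwarz X Y x y :
  0 <= (rinner (phi (X * adj X) x) x - rnorm (adj (phi X) x) ^+ 2)
     + 2 * rinner ((phi (X * Y) - phi X * phi Y) y) x
     + (rinner (phi (adj Y * Y) y) y - rnorm (phi Y y) ^+ 2).
Proof.
have -> : rinner ((phi (X * Y) - phi X * phi Y) y) x =
    rinner (phi (X * Y) y) x - rinner (phi Y y) (adj (phi X) x).
  by rewrite bopDE bop_oppE bop_mulE rinnerDl rinnerNl (rinner_adj (phi X)).
set z := - (adj (phi X) x + phi Y y).
have := UCP_gram (fun i : 'I_3 => nth 0 [:: X; adj Y; 1] i)
  (fun i => nth 0 [:: x; y; z] i).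
rewrite !big_ord_recl !big_ord0 /= !addr0 bop_adj1 !mulr1 !mul1r UCP1 bop_adjK.
rewrite -bop_adjM !UCP_adj.
set s := _ + _ => s0; have {s0} : 0 <= complex.Re s.
  by move: s0; case: s => a b; rewrite lecE => /andP[].
rewrite /s !raddfD/= -!/(rinner _ _).
rewrite (rinner_adj (phi X) z) (rinner_adjl (phi Y) z).
rewrite (rinner_adjl (phi (X * Y))).
rewrite (rinnerC x (phi (X * Y) y)).
rewrite (rinnerC (adj (phi X) x) z) (rinnerC (phi Y y) z) rinner_rnorm.
have -> : rnorm z ^+ 2 = - (rinner z (adj (phi X) x) + rinner z (phi Y y)).
  by rewrite -rinnerDr -rinnerNr -rinner_rnorm.
have : - (rinner z (adj (phi X) x) + rinner z (phi Y y)) =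
   rnorm (adj (phi X) x) ^+ 2 +
   2 * rinner (phi Y y) (adj (phi X) x) + rnorm (phi Y y) ^+ 2.
  by rewrite -rinnerDr -rinnerNl opprK rinner_rnorm rnormD2 (rinnerC (phi Y y)).
lra.
Qed.

Lemma UCP_kadison X x :
  rnorm (adj (phi X) x) ^+ 2 <= rinner (phi (X * adj X) x) x.
Proof.
by have := UCP_schwarz X 1 x 0; rewrite !linear0 !rinner0l rnorm0; lra.
Qed.

(** [UCP_kadison] at [adj X] bounds [|phi X x|^2] by the form of [phi (adj X * X)], which
    [UCP_sqr_le] bounds in turn. *)
Lemma UCP_contract X : rnorm (phi X) <= rnorm X.
Proof.
apply: rnorm_op_le => [|x]; first exact: rnorm_ge0.
rewrite -(ler_pXn2r (ltn0Sn 1)) ?nnegrE ?mulr_ge0 ?rnorm_ge0// exprMn.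
have := UCP_kadison (adj X) x; rewrite UCP_adj !bop_adjK => h.
exact: le_trans h (UCP_sqr_le _ _).
Qed.

(** A quantitative multiplicative domain argument: in [UCP_schwarz], take [x] to be a negative
    multiple of [D y], so that the cross term is controlled by the defect of [X] and by
    [|Y|^2 |y|^2]. *)
Lemma UCP_defect X Y (e : R) : 0 <= e ->
  (forall x, rinner (phi (X * adj X) x) x - rnorm (adj (phi X) x) ^+ 2
     <= e * rnorm x ^+ 2) ->
  rnorm (phi (X * Y) - phi X * phi Y) ^+ 2 <= e * rnorm Y ^+ 2.
Proof.
move=> e0 he; set D := _ - _.
apply: (@le_eps _ (rnorm Y ^+ 2)) => [|d d0]; first exact: sqr_ge0.
have ed : 0 < e + d by rewrite ltr_wpDl.
rewrite -mulrDl -(@sqr_sqrtr _ (e + d)) ?(ltW ed)// -exprMn.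
rewrite ler_pXn2r ?nnegrE ?mulr_ge0 ?rnorm_ge0 ?sqrtr_ge0//.
apply: rnorm_op_le => [|y]; first by rewrite mulr_ge0 ?rnorm_ge0 ?sqrtr_ge0.
rewrite -(ler_pXn2r (ltn0Sn 1)) ?nnegrE ?mulr_ge0 ?rnorm_ge0 ?sqrtr_ge0//.
rewrite !exprMn sqr_sqrtr ?(ltW ed)//.
(* The added [d] makes [t] meaningful when [e = 0]. This [t] gives [e * t ^+ 2 <= t], so the defect
   of [X] uses up only half of the cross term [2 * t * q]. *)
pose t := (e + d)^-1; have t0 : 0 < t by rewrite invr_gt0.
pose q := rnorm (D y) ^+ 2; pose x := (- t)%:C *: D y.
have xD : rinner (D y) x = - (t * q) by rewrite rinnerZr rinner_rnorm mulNr.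
have nx : rnorm x ^+ 2 = t ^+ 2 * q by rewrite rnormZ normrN (gtr0_norm t0)
  exprMn.
have := UCP_schwarz X Y x y; have := he x; rewrite -/D xD nx => h1 h2.
have := UCP_sqr_le Y y; have := sqr_ge0 (rnorm (phi Y y)) => h3 h4.
rewrite -/q.
have q0 : 0 <= q by exact: sqr_ge0.
have etq : e * (t ^+ 2 * q) <= t * q.
  rewrite expr2 -mulrA mulrCA ler_wpM2l ?(ltW t0)// mulrA ler_piMl//.
  by rewrite ler_pdivrMr// mul1r lerDl ltW.
have h5 : t * q <= rnorm Y ^+ 2 * rnorm y ^+ 2 by lra.
by rewrite -mulrA -ler_pdivrMl.
Qed.

End UCPSchwarz.

(** * Real sequences that tend to 0 *)

Section Vanishing.
Variable R : realType.
Implicit Types u v : nat -> R.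

(** One-sided, with no absolute value: this is convergence to 0 for nonnegative sequences, as
    [vanishP] states. *)
Definition vanish u :=
  forall e, 0 < e -> exists N, forall k, (N <= k)%N -> u k < e.

Lemma vanishP u : (forall k, 0 <= u k) -> vanish u <-> u @ \oo --> (0 : R).
Proof.
move=> u0; split=> [vu|/cvgrPdist_lt cu e e0].
  apply/cvgrPdist_lt => e /vu[N uN]; exists N => // k /uN.
  by rewrite sub0r normrN ger0_norm.
have [N _ uN] := cu e e0; exists N => k /uN.
by rewrite sub0r normrN ger0_norm.
Qed.

Lemma vanish_le u v (C : R) : 0 <= C -> (forall k, u k <= C * v k) ->
  vanish v -> vanish u.
Proof.
move=> C0 uv vv e e0; have C1 : 0 < C + 1 by rewrite ltr_wpDl.
have [N vN] := vv (e / (C + 1)) ltac:(by rewrite divr_gt0).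
exists N => k /vN; rewrite ltr_pdivlMr// => h; apply: le_lt_trans (uv k) _.
(* [vanish] allows [v k] to be negative, and then [C * v k <= 0]. *)
by have [v0|v0] := leP 0 (v k); nra.
Qed.

Lemma vanishD u v : vanish u -> vanish v -> vanish (fun k => u k + v k).
Proof.
move=> vu vv e e0; have e2 : 0 < e / 2 by rewrite divr_gt0.
have [N uN] := vu _ e2; have [M vM] := vv _ e2; exists (maxn N M) => k.
by rewrite geq_max => /andP[/uN ? /vM ?]; lra.
Qed.

Lemma vanish0 : vanish (fun=> 0). Proof. by move=> e e0; exists 0%N. Qed.

Lemma vanish_sum n (u : 'I_n -> nat -> R) : (forall i, vanish (u i)) ->
  vanish (fun k => \sum_i u i k).
Proof.
elim: n u => [u _|n IH u vu].
  by apply: vanish_le (lexx 0) _ vanish0 => k; rewrite big_ord0 mul0r.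
apply: vanish_le ler01 _ (vanishD (vu ord0) (IH (fun i => u (lift ord0 i)) _))
  => [k|//].
by rewrite mul1r big_ord_recl.
Qed.

Lemma vanish_sqr u : (forall k, 0 <= u k) -> vanish (fun k => u k ^+ 2) ->
  vanish u.
Proof.
move=> u0 vu e e0; have [N uN] := vu (e ^+ 2) ltac:(by rewrite exprn_gt0).
by exists N => k /uN; rewrite ltr_pXn2r ?nnegrE ?(ltW e0).
Qed.

Lemma vanish_adherent u :
  (forall e, 0 < e -> exists2 v, vanish v & forall k, u k <= v k + e) ->
  vanish u.
Proof.
move=> uv e e0; have e2 : 0 < e / 2 by rewrite divr_gt0.
have [v /(_ _ e2)[N vN] uvk] := uv _ e2.
by exists N => k /vN; have := uvk k; lra.
Qed.

End Vanishing.

(** * Asymptotic multipliers and their closure properties *)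

Section AsymptoticMultipliers.
Variables (R : realType) (K : hilbertType R) (phi : nat -> bop K -> bop K).
Hypothesis Uphi : forall k, UCP (phi k).
Implicit Types (X Y : bop K).

Definition asymptotic_multiplier X :=
  forall Y, vanish (fun k => rnorm (phi k (X * Y) - X * phi k Y)).

Lemma asymptotic_multiplier_lin a X X' : asymptotic_multiplier X ->
  asymptotic_multiplier X' -> asymptotic_multiplier (a *: X + X').
Proof.
move=> mX mX' Y.
have a0 : 0 <= complex.Re `|a| by exact: (@rnorm_ge0 _ R[i]^o).
have maX :
    vanish (fun k => complex.Re `|a| * rnorm (phi k (X * Y) - X * phi k Y)).
  exact: vanish_le a0 (fun=> lexx _) (mX Y).
apply: vanish_le ler01 _ (vanishD maX (mX' Y)) => k; rewrite mul1r -rnormZc.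
apply: le_trans (rnormD _ _).
rewrite !mulrDl.
have sM (S T : bop K) : (a *: S) * T = a *: (S * T) by exact: bopP.
by rewrite !sM UCP_linear// opprD scalerBr addrACA.
Qed.

Lemma asymptotic_multiplier0 : asymptotic_multiplier 0.
Proof.
move=> Y; apply: vanish_le (lexx 0) _ (@vanish0 R) => k.
by rewrite !mul0r UCP0// subr0 rnorm0.
Qed.

(** Pull out [X] against [X' * Y], then [X'] against [Y]; the first move relies on the second factor
    being arbitrary in the definition. *)
Lemma asymptotic_multiplierM X X' : asymptotic_multiplier X ->
  asymptotic_multiplier X' -> asymptotic_multiplier (X * X').
Proof.
move=> mX mX' Y.
have mXX' : vanish (fun k => rnorm X * rnorm (phi k (X' * Y) - X' * phi k Y)).
  exact: vanish_le (rnorm_ge0 X) (fun=> lexx _) (mX' Y).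
apply: vanish_le ler01 _ (vanishD (mX (X' * Y)) mXX') => k; rewrite mul1r.
apply: le_trans (rnorm_tri _ (X * phi k (X' * Y)) _) _; rewrite mulrA lerD2l.
by rewrite -mulrA -mulrBr rnormM.
Qed.

(** Replacing [X] by [X'] costs at most [2 |X - X'| |Y|], uniformly in [k] because each [phi k] is
    contractive. *)
Lemma asymptotic_multiplier_adherent X :
  (forall e : R, 0 < e ->
     exists2 X', asymptotic_multiplier X' & rnorm (X - X') < e) ->
  asymptotic_multiplier X.
Proof.
move=> adh Y; apply: vanish_adherent => e e0.
have Y0 := rnorm_ge0 Y; have d0 : 0 < 2 * rnorm Y + 1 by lra.
have [X' mX' XX'] := adh (e / (2 * rnorm Y + 1)) ltac:(by rewrite divr_gt0).
move: XX'; rewrite ltr_pdivlMr// => XX'.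
exists (fun k => rnorm (phi k (X' * Y) - X' * phi k Y)) => // k.
have -> : phi k (X * Y) - X * phi k Y = (phi k (X' * Y) - X' * phi k Y) +
    (phi k ((X - X') * Y) - (X - X') * phi k Y).
  by rewrite addrACA -UCPD// -opprD -!mulrDl [X' + _]addrC subrK.
apply: le_trans (rnormD _ _) _; rewrite lerD2l;
  apply: le_trans (rnormD _ _) _; rewrite rnormN.
have := UCP_contract (Uphi k) ((X - X') * Y); have := rnormM (X - X') Y.
have := rnormM (X - X') (phi k Y); have := UCP_contract (Uphi k) Y.
have := rnorm_ge0 (X - X'); move: XX'; move: (rnorm (X - X')) => d *.
have : d * rnorm (phi k Y) <= d * rnorm Y by exact: ler_wpM2l.
nra.
Qed.

(** Compare through [phi k X * phi k Y]: [UCP_defect] bounds the square of the first gap, and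
    convergence at [X] with contractivity of [phi k] bounds the second. *)
Lemma asymptotic_multiplier_of_defect X (eps : nat -> R) :
  (forall k, 0 <= eps k) -> vanish eps ->
  (forall k x, rinner (phi k (X * adj X) x) x - rnorm (adj (phi k X) x) ^+ 2
     <= eps k * rnorm x ^+ 2) ->
  vanish (fun k => rnorm (phi k X - X)) -> asymptotic_multiplier X.
Proof.
move=> eps0 veps defX vX Y.
have vD : vanish (fun k => rnorm (phi k (X * Y) - phi k X * phi k Y)).
  apply: vanish_sqr => [k|]; first exact: rnorm_ge0.
  apply: vanish_le (sqr_ge0 (rnorm Y)) _ veps => k.
  by rewrite mulrC UCP_defect.
have vXY : vanish (fun k => rnorm Y * rnorm (phi k X - X)).
  exact: vanish_le (rnorm_ge0 Y) (fun=> lexx _) vX.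
apply: vanish_le ler01 _ (vanishD vD vXY) => k; rewrite mul1r.
apply: le_trans (rnorm_tri _ (phi k X * phi k Y) _) _;
  rewrite lerD2l -mulrBl mulrC.
apply: le_trans (rnormM _ _) _; rewrite ler_wpM2l ?rnorm_ge0//.
exact: UCP_contract.
Qed.

(** * Isometries and their adjoints as asymptotic multipliers *)

Section Isometries.
Variables (n : nat) (W : 'I_n -> bop K).
Hypotheses (WW : forall i, adj (W i) * W i = 1)
  (vW : forall i, vanish (fun k => rnorm (phi k (W i) - W i)))
  (vS : vanish (fun k =>
     rnorm (phi k (\sum_i W i * adj (W i)) - \sum_i W i * adj (W i)))).

Let nW i x : rnorm (W i x) = rnorm x.
Proof.
apply/eqP; rewrite -(eqrXn2 (ltn0Sn 1)) ?rnorm_ge0//; apply/eqP.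
by rewrite -!rinner_rnorm rinner_adj -bop_mulE WW.
Qed.

Let nW1 i : rnorm (W i) <= 1.
Proof. by apply: rnorm_op_le => // x; rewrite nW mul1r. Qed.

Let vWadj i : vanish (fun k => rnorm (phi k (adj (W i)) - adj (W i))).
Proof.
apply: vanish_le ler01 _ (vW i) => k.
by rewrite mul1r UCP_adj// -bop_adjN -bop_adjD rnorm_adj.
Qed.

(* The defect of [adj (W i)] at [x] is [|W i x|^2 - |phi (W i) x|^2]. *)
Lemma asymptotic_multiplier_adj_isometry i : asymptotic_multiplier (adj (W i)).
Proof.
(* With [a = |x| = |W i x|], [b = |phi k (W i) x| <= a] and [d = |phi k (W i) - W i|], the defect is
   [(a - b) * (a + b)], at most [(d * a) * (2 * a)]. *)
pose eps k := 2 * rnorm (phi k (W i) - W i).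
apply: (@asymptotic_multiplier_of_defect _ eps) => //.
- by move=> k; rewrite mulr_ge0 ?rnorm_ge0.
- exact: vanish_le (ler0n _ 2) (fun=> lexx _) (vW i).
move=> k x; rewrite bop_adjK WW UCP1// rinner_rnorm UCP_adj// bop_adjK /eps.
have := rnorm_tri (W i x) (phi k (W i) x) 0; rewrite !subr0 nW rnormB.
have := rnorm_app (phi k (W i) - W i) x; rewrite bopDE bop_oppE.
have := rnorm_ge0 x; have := rnorm_ge0 (phi k (W i) x);
  have := rnorm_ge0 (phi k (W i) - W i).
have : rnorm (phi k (W i) x) <= rnorm x.
  apply: le_trans (rnorm_app _ _) _; rewrite ler_piMl ?rnorm_ge0//.
  exact: le_trans (UCP_contract (Uphi k) _) (nW1 i).
move: (rnorm (_ - _)) (rnorm (phi k (W i) x)) (rnorm x)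
  (rnorm (phi k (W i) x - W i x)) => d b a c *.
have : (a - b) * (a + b) <= (d * a) * (a + b) by apply: ler_wpM2r; lra.
have : (d * a) * (a + b) <= (d * a) * (2 * a) by apply: ler_wpM2l;
  [exact: mulr_ge0|lra].
nra.
Qed.

(* The defects of the [W i] are nonnegative by the Kadison-Schwarz inequality
   and their sum vanishes asymptotically, hence so does each of them. *)
Lemma asymptotic_multiplier_isometry i : asymptotic_multiplier (W i).
Proof.
pose S := \sum_i W i * adj (W i).
(* The summed defect at [x] is the form of [phi k S - S] plus the sum over [j] of [|adj (W j) x|^2 -
   |adj (phi k (W j)) x|^2]; the two terms of [eps] bound these in turn. *)
pose eps k := rnorm (phi k S - S) + \sum_j 2 * rnorm (phi k (W j) - W j).
apply: (@asymptotic_multiplier_of_defect _ eps) => //.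
- by move=> k; rewrite addr_ge0 ?rnorm_ge0// sumr_ge0// => j _;
    rewrite mulr_ge0 ?rnorm_ge0.
- apply: vanishD => //; apply: vanish_sum => j;
    exact: vanish_le (ler0n _ 2) (fun=> lexx _) (vW j).
move=> k x.
pose E j :=
  rinner (phi k (W j * adj (W j)) x) x - rnorm (adj (phi k (W j)) x) ^+ 2.
have E0 j : 0 <= E j by rewrite subr_ge0 UCP_kadison.
have EiE : E i <= \sum_j E j by rewrite (bigD1 i)//= lerDl sumr_ge0.
have sumE (T : 'I_n -> bop K) :
    rinner ((\sum_j T j) x) x = \sum_j rinner (T j x) x.
  by apply: (big_morph (fun T : bop K => rinner (T x) x)) => [T1 T2|];
    rewrite ?rinnerDl ?rinner0l.
apply: le_trans EiE _; rewrite sumrB -sumE -UCP_sum// -/S.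
have -> : rinner (phi k S x) x =
    rinner ((phi k S - S) x) x + \sum_j rnorm (adj (W j) x) ^+ 2.
  rewrite bopDE bop_oppE rinnerDl rinnerNl -[LHS]addr0 -addrA; congr (_ + _).
  rewrite sumE -sumrN -big_split/= big1// => j _.
  by rewrite (rinner_adj (W j)) rinner_rnorm addNr.
rewrite -addrA -sumrB /eps mulrDl; apply: lerD.
  rewrite (le_trans (rinner_le _ _))// expr2 mulrA ler_wpM2r ?rnorm_ge0//.
  exact: rnorm_app.
rewrite mulr_suml; apply: ler_sum => j _.
(* A difference of squares again, now with both norms merely bounded by [|x|], since [adj (W j)] is
   only contractive. *)
have := rnorm_tri (adj (W j) x) (adj (phi k (W j)) x) 0; rewrite !subr0 rnormB.
have := rnorm_app (adj (phi k (W j) - W j)) x;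
  rewrite bop_adjD bop_adjN bopDE bop_oppE.
have := rnorm_adj (phi k (W j) - W j); rewrite bop_adjD bop_adjN.
have := rnorm_ge0 x; have := rnorm_ge0 (adj (phi k (W j)) x);
  have := rnorm_ge0 (adj (W j) x).
have : rnorm (adj (phi k (W j)) x) <= rnorm x.
  apply: le_trans (rnorm_app _ _) _; rewrite ler_piMl ?rnorm_ge0//.
  exact: le_trans (rnorm_adj _) (le_trans (UCP_contract (Uphi k) _) (nW1 j)).
have : rnorm (adj (W j) x) <= rnorm x.
  apply: le_trans (rnorm_app _ _) _; rewrite ler_piMl ?rnorm_ge0//.
  exact: le_trans (rnorm_adj _) (nW1 j).
have := rnorm_ge0 (phi k (W j) - W j).
move: (rnorm (phi k (W j) - W j)) (rnorm (adj (phi k (W j)) - adj (W j)))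
  (rnorm (adj (W j) x))
  (rnorm (adj (phi k (W j)) x)) (rnorm x)
  (rnorm (adj (phi k (W j)) x - adj (W j) x)).
move=> d d' a b c f d0 ac bc a0 b0 c0 dd' fd ab.
have abd : a - b <= d * c by have : d' * c <= d * c by [exact: ler_wpM2r]; lra.
have : (a - b) * (a + b) <= (d * c) * (a + b) by apply: ler_wpM2r; lra.
have : (d * c) * (a + b) <= (d * c) * (2 * c) by apply: ler_wpM2l;
  [exact: mulr_ge0|lra].
nra.
Qed.

End Isometries.
End AsymptoticMultipliers.

(** * The generated C*-algebra, its unit, and hyperrigidity *)

Lemma cstar_generated_subalgebra (R : realType) (H : hilbertType R)
  (G : set (bop H)) : cstar_subalgebra (cstar_generated G).
Proof.
split=> [B [cB _]|a S T AS AT B BG|S T AS AT B BG|T AT B BG|].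
- exact: cstar0.
- by apply: (cstarP BG.1); [exact: AS|exact: AT].
- by apply: (cstarM BG.1); [exact: AS|exact: AT].
- by apply: (cstarV BG.1); exact: AT.
- by apply: closed_bigI => B [cB _]; exact: cstar_closed.
Qed.

Lemma sub_cstar_generated (R : realType) (H : hilbertType R) (G : set (bop H)) :
  G `<=` cstar_generated G.
Proof. by move=> T GT B [_]; apply. Qed.

(** The fixed vectors of [pi 1] form a closed subspace containing every [pi T x] with [T] in [A], so
    nondegeneracy makes it all of [K]. *)
Lemma nondegenerate_unit (R : realType) (H K : hilbertType R) (A : set (bop H))
    (pi : bop H -> bop K) :
  A 1 -> representation A pi -> Defs.nondegenerate A pi -> pi 1 = 1.
Proof.
move=> A1 rpi ndpi; have piA T : A T -> pi 1 * pi T = pi T.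
  by move=> AT; rewrite -(reprM rpi)// mul1r.
have cM : closed_subspace [set x | pi 1 x = x].
  split=> [|a x y /= xE yE|]; first exact: linear0.
    by rewrite (bop_linear (pi 1)) xE yE.
  apply: closed_of_adherent => x adh.
  apply/eqP; rewrite -subr_eq0; apply/eqP/rnorm_eq0/le_anti;
    rewrite rnorm_ge0 andbT.
  apply: (@le_eps _ (rnorm (pi 1) + 1)) => [|e /adh[y /= yE xy]].
    by rewrite addr_ge0 ?rnorm_ge0.
  rewrite add0r mulrDr mulr1; apply: le_trans (rnorm_tri _ (pi 1 y) _) _.
  apply: lerD; last by rewrite yE rnormB ltW.
  rewrite -raddfB (le_trans (rnorm_app _ _))// mulrC ler_wpM2r ?rnorm_ge0//
    ltW//.
have MT : [set x | pi 1 x = x] = setT.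
  by apply: ndpi => // T x AT /=; rewrite -bop_mulE piA.
apply: bopP => x; have : [set x | pi 1 x = x] x by rewrite MT.
by [].
Qed.

Theorem theorem1p3 (R : realType) (H : hilbertType R) (n : nat)
    (V : 'I_n -> bop H) (isoV : forall i, isometry_op (V i)) :
  hyperrigid_generator (cstar_generated (range V))
    (range V `|` [set \sum_(i < n) V i * adj (V i)]).
Proof.
set A := cstar_generated (range V); set G := _ `|` _.
have cA : cstar_subalgebra A := cstar_generated_subalgebra (range V).
have AV i : A (V i) by apply: sub_cstar_generated; exists i.
have AVV i : A (V i * adj (V i)) by apply: (cstarM cA) => //;
  exact: (cstarV cA).
split.
- apply: finite_set_countable; rewrite finite_setU; split=> //.
  exact: finite_image.
(* A C*-subalgebra contains [G] exactly when it contains the range of [V], so both sides intersect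
   the same family. *)
- apply/seteqP; split=> T AT B [cB GB]; apply: AT; split=> //.
    move=> _ [[i _ <-]|->]; first by apply: GB; exists i.
    apply: (cstar_sum cB) => i; apply: (cstarM cB); last apply: (cstarV cB).
      by apply: GB; exists i.
    by apply: GB; exists i.
  by move=> S VS; apply: GB; left.
move=> K pi rpi _ ndpi phi Uphi cvG a Aa.
have pi0 := representation0 (cstar0 cA) rpi.
have piD := representationD rpi.
(* The index [i] supplies [1 = adj (V i) * V i] in [A]. For [n = 0] there is nothing to prove here,
   and [A] need not contain 1. *)
have WW i : adj (pi (V i)) * pi (V i) = 1.
  have AVi := cstarV cA (AV i).
  rewrite -(reprV rpi)// -(reprM rpi)// (isometry_adjM (isoV i)).
  apply: nondegenerate_unit rpi ndpi.
  by rewrite -(isometry_adjM (isoV i)); exact: (cstarM cA).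
have piS : pi (\sum_i V i * adj (V i)) = \sum_i pi (V i) * adj (pi (V i)).
  (* [pi] is known to be additive only on [A], so the induction carries membership of the partial
     sums. *)
  suff [] : A (\sum_i V i * adj (V i)) /\
    pi (\sum_i V i * adj (V i)) = \sum_i pi (V i) * adj (pi (V i)) by [].
  apply: (big_rec2 (fun S T => A S /\ pi S = T)) => [|i S T _ [AS <-]].
    by split; first exact: (cstar0 cA).
  split; first exact: (cstarD cA).
  by rewrite piD// (reprM rpi) ?(reprV rpi)//; exact: (cstarV cA).
have vG g : G g -> vanish (fun k => rnorm (phi k (pi g) - pi g)).
  by move=> Gg; apply/vanishP => [k|]; [exact: rnorm_ge0|exact: cvG].
have vV i : vanish (fun k => rnorm (phi k (pi (V i)) - pi (V i))).
  by apply: vG; left; exists i.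
have vS := vG _ (or_intror (erefl _)); rewrite piS in vS.
pose B := [set T | [/\ A T, asymptotic_multiplier phi (pi T) &
  asymptotic_multiplier phi (adj (pi T))]].
have cB : cstar_subalgebra B.
  split.
  - split; first exact: (cstar0 cA).
      by rewrite pi0; exact: asymptotic_multiplier0.
    by rewrite pi0 bop_adj0; exact: asymptotic_multiplier0.
  - move=> c S T [AS mS mS'] [AT mT mT']; split; first exact: (cstarP cA).
      by rewrite (reprP rpi)//; exact: asymptotic_multiplier_lin.
    by rewrite (reprP rpi)// bop_adjD bop_adjZ;
      exact: asymptotic_multiplier_lin.
  - move=> S T [AS mS mS'] [AT mT mT']; split; first exact: (cstarM cA).
      by rewrite (reprM rpi)//; exact: asymptotic_multiplierM.
    by rewrite (reprM rpi)// bop_adjM; exact: asymptotic_multiplierM.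
  - by move=> T [AT mT mT']; split; rewrite ?(reprV rpi) ?bop_adjK//;
      exact: (cstarV cA).
  apply: closed_of_adherent => T adhT.
  have AT : A T.
    by apply: closed_adherent (cstar_closed cA) _ => e /adhT[S [AS _ _] TS];
      exists S.
  (* Boundedness of [pi] transports approximation from [A] to its image; [e / 2] absorbs the
     constant 2 of [representation_le2]. *)
  have pi_close e : 0 < e -> exists2 S, B S & rnorm (pi T - pi S) < e.
    move=> e0; have [S BS TS] := adhT (e / 2) ltac:(by rewrite divr_gt0).
    exists S => //; have [AS _ _] := BS.
    have -> : pi T - pi S = pi (T - S).
      by rewrite addrC -scaleN1r -(reprP rpi)// scaleN1r addrC.
    have : A (T - S) by rewrite addrC -scaleN1r; exact: (cstarP cA).
    by move=> /(representation_le2 cA rpi); lra.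
  split=> //; apply: asymptotic_multiplier_adherent => // e
      /pi_close[S [_ mS mS'] TS].
    by exists (pi S).
  by exists (adj (pi S)) => //;
    rewrite -bop_adjN -bop_adjD (le_lt_trans (rnorm_adj _)).
have BV : range V `<=` B.
  move=> _ [i _ <-]; split=> //.
    exact: (asymptotic_multiplier_isometry Uphi WW vV vS).
  exact: (asymptotic_multiplier_adj_isometry Uphi WW vV).
have [_ ma _] := Aa B (conj cB BV).
apply/(@vanishP R (fun k => rnorm (phi k (pi a) - pi a))) => [k|];
  first exact: rnorm_ge0.
apply: vanish_le ler01 _ (ma 1) => k.
by rewrite mul1r mulr1 UCP1// mulr1.
Qed.
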